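(* For every PDL_{REwLA+} formula φ, φ is valid on the class of all generalized structures that are isomorphic to a string structure (after setting every formula variable to be interpreted as the empty set) if and only if φ is derivable in the Hilbert system for PDL_{REwLA+} on finite linear orders extended with the three additional axioms listed below.
   Context: Fix disjoint sets of term variables x, y, ... and formula variables p, .... PDL_{REwLA+} formulas and terms are defined mutually by: formulas φ ::= p | φ → ψ | F | [t]φ; terms t ::= x | t;u | t+u | t^+ | t^a | t^{∩id} | t^{∩comid} | φ?. Abbreviations: ¬φ = φ → F, T = ¬F, ∨, ∧, ↔ as usual, ⟨t⟩φ = ¬[t]¬φ, t^* = 1 + t^+ with 1 = T?, 0 = F?. A generalized structure S consists of a nonempty universe, a ''universal relation'' (here a preorder), a binary relation x^S contained in the universal relation for each term variable, and a subset p^S for each formula variable. Terms denote binary relations: ; is relational composition, + is union, t^+ is transitive closure, t^a (antidomain / negative lookahead) is {(v,v) : v has no t-successor}, t^{∩id} is t intersected with the identity relation, t^{∩comid} is t minus the identity relation, φ? is {(v,v) : v satisfies φ}. Formulas denote sets of points: → is classical implication, F is empty, [t]φ is the set of points all of whose t-successors satisfy φ. A formula is valid on a class if it holds at every point of every structure in the class. The string structure of a string w = a_1…a_n has universe {0,…,n}, universal relation {(i,j) : i ≤ j}, x interpreted as {(i,i+1) : a_{i+1} = x}, and every formula variable interpreted as ∅. The base Hilbert system (for PDL_{REwLA+} on finite linear orders) has rules Modus Ponens (from φ and φ→ψ infer ψ) and Necessitation (from φ infer [t]φ), and axioms: (PDL) all substitution instances of PDL formulas valid on all Kripke structures; (antidomain)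 [t^a]φ ↔ [[t]F?]φ; (∩id axioms) [t^{∩id}]φ ↔ [⟨t^{∩id}⟩T?]φ, [(tu)^{∩id}]φ ↔ [t^{∩id}u^{∩id}]φ, [(t+u)^{∩id}]φ ↔ [t^{∩id}+u^{∩id}]φ, [(t^+)^{∩id}]φ ↔ [t^{∩id}]φ, [(t^a)^{∩id}]φ ↔ [t^a]φ, [(t^{∩id})^{∩id}]φ ↔ [t^{∩id}]φ, [(t^{∩comid})^{∩id}]φ ↔ T, [(ψ?)^{∩id}]φ ↔ [ψ?]φ; (∩comid axioms) [t]φ ↔ [t^{∩id}+t^{∩comid}]φ, [(tu)^{∩comid}]φ ↔ [t^{∩comid}u^{∩id} + t^{∩id}u^{∩comid} + t^{∩comid}u^{∩comid}]φ, [(t+u)^{∩comid}]φ ↔ [t^{∩comid}+u^{∩comid}]φ, [(t^+)^{∩comid}]φ ↔ [(t^{∩comid})^+]φ, [(t^a)^{∩comid}]φ ↔ T, [(t^{∩id})^{∩comid}]φ ↔ T, [(t^{∩comid})^{∩comid}]φ ↔ [t^{∩comid}]φ, [(ψ?)^{∩comid}]φ ↔ T; (restricted Löb) [(t^{∩comid})^+]([(t^{∩comid})^+]φ → φ) → [(t^{∩comid})^+]φ. The three additional axioms, for term variables x, y, are: ⟨x^{∩id}⟩T ↔ F; ⟨x⟩φ → [x]φ (determinism); and ⟨x⟩φ → [y]ψ for distinct term variables x ≠ y (at most one outgoing label). These additional axioms are not closed under substitution of term variables. *)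

(* Defs.v *)
From Stdlib Require Import Relation_Operators.
From mathcomp Require Import all_boot.

Set Implicit Arguments.
Unset Strict Implicit.
Unset Printing Implicit Defensive.

Section Syntax.
Variables V P : Type.

Inductive formula : Type :=
  | FVar of P
  | FImp of formula & formula
  | FBot
  | FBox of term & formula
with term : Type :=
  | TVar of V
  | TSeq of term & term
  | TAlt of term & term
  | TPlus of term
  | TAnti of term
  | TCapId of term
  | TCapComid of term
  | TTest of formula.

Definition FNeg (A : formula) : formula := FImp A FBot.
Definition FTop : formula := FNeg FBot.
Definition FAnd (A B : formula) : formula := FNeg (FImp A (FNeg B)).
Definition FIff (A B : formula) : formula := FAnd (FImp A B) (FImp B A).
Definition FDia (t : term) (A : formula) : formula := FNeg (FBox t (FNeg A)).

(* PDL is the fragment without antidomain, cap-id and cap-comid. *)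
Fixpoint is_pdl (A : formula) : bool :=
  match A with
  | FVar _ | FBot => true
  | FImp A B => is_pdl A && is_pdl B
  | FBox t A => is_pdl_term t && is_pdl A
  end
with is_pdl_term (t : term) : bool :=
  match t with
  | TVar _ => true
  | TSeq t u | TAlt t u => is_pdl_term t && is_pdl_term u
  | TPlus t => is_pdl_term t
  | TAnti _ | TCapId _ | TCapComid _ => false
  | TTest A => is_pdl A
  end.

End Syntax.

Arguments FVar {V P}.
Arguments FBot {V P}.
Arguments FTop {V P}.
Arguments TVar {V P}.

Section Substitution.
Variables V P V' P' : Type.
Variables (s : V -> term V' P') (r : P -> formula V' P').

Fixpoint fsubst (A : formula V P) : formula V' P' :=
  match A with
  | FVar p => r p
  | FImp A B => FImp (fsubst A) (fsubst B)
  | FBot => FBot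
  | FBox t A => FBox (tsubst t) (fsubst A)
  end
with tsubst (t : term V P) : term V' P' :=
  match t with
  | TVar x => s x
  | TSeq t u => TSeq (tsubst t) (tsubst u)
  | TAlt t u => TAlt (tsubst t) (tsubst u)
  | TPlus t => TPlus (tsubst t)
  | TAnti t => TAnti (tsubst t)
  | TCapId t => TCapId (tsubst t)
  | TCapComid t => TCapComid (tsubst t)
  | TTest A => TTest (fsubst A)
  end.

End Substitution.

Section Semantics.
Variables V P : Type.

Record kripke : Type := Kripke {
  point :> Type;
  point_inhabited : inhabited point;
  rel_of : V -> point -> point -> Prop;
  val_of : P -> point -> Prop
}.

Fixpoint sat (K : kripke) (A : formula V P) (u : K) : Prop :=
  match A with
  | FVar p => val_of p u
  | FImp A B => sat A u -> sat B u
  | FBot => False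
  | FBox t A => forall v, trel t u v -> sat A v
  end
with trel (K : kripke) (t : term V P) (u v : K) : Prop :=
  match t with
  | TVar x => rel_of x u v
  | TSeq t1 t2 => exists2 w, trel t1 u w & trel t2 w v
  | TAlt t1 t2 => trel t1 u v \/ trel t2 u v
  | TPlus t1 => clos_trans K (fun a b => trel t1 a b) u v
  | TAnti t1 => u = v /\ ~ (exists w, trel t1 u w)
  | TCapId t1 => trel t1 u v /\ u = v
  | TCapComid t1 => trel t1 u v /\ u <> v
  | TTest A => u = v /\ sat A u
  end.

Record gstruct : Type := GStruct {
  gkripke :> kripke;
  univ : gkripke -> gkripke -> Prop;
  univ_refl : forall u, univ u u;
  univ_trans : forall u v w, univ u v -> univ v w -> univ u w;
  rel_univ : forall (x : V) u v, rel_of x u v -> univ u v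
}.

Definition valid_kripke (A : formula V P) : Prop :=
  forall (K : kripke) (u : K), sat A u.

Definition valid_on (C : gstruct -> Prop) (A : formula V P) : Prop :=
  forall S : gstruct, C S -> forall u : S, sat A u.

Definition isomorphic (S S' : gstruct) : Prop :=
  exists f : S -> S',
    [/\ bijective f,
        forall u v, univ u v <-> univ (f u) (f v),
        forall (x : V) u v, rel_of x u v <-> rel_of x (f u) (f v)
      & forall (p : P) u, val_of p u <-> val_of p (f u)].

Section StringStructure.
Variable w : seq V.

(* [onth] is 0-based, so the letter a_(i+1) labelling the edge from i to i+1
   is [onth w i]. *)
Definition string_kripke : kripke :=
  @Kripke 'I_(size w).+1 (inhabits ord0)
    (fun (x : V) i j => j = i.+1 :> nat /\ onth w i = Some x)
    (fun _ _ => False).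

Lemma string_rel_univ (x : V) (i j : 'I_(size w).+1) :
  @rel_of string_kripke x i j -> i <= j.
Proof. by case=> -> _. Qed.

Definition string_struct : gstruct :=
  @GStruct string_kripke (fun i j : 'I_(size w).+1 => i <= j)
    (fun i => leqnn i) (fun _ _ _ ij jk => leq_trans ij jk) string_rel_univ.

End StringStructure.

Definition clear_vars (S : gstruct) : gstruct :=
  @GStruct (@Kripke S (point_inhabited S) (@rel_of S) (fun _ _ => False))
    (@univ S) (@univ_refl S) (@univ_trans S) (@rel_univ S).

(* The formula variables of a member are unconstrained: it is [clear_vars S],
   not [S] itself, that has to be isomorphic to a string structure. *)
Definition string_class (S : gstruct) : Prop :=
  exists w : seq V, isomorphic (clear_vars S) (string_struct w).

End Semantics.

Section Hilbert.
Variables V P : Type.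
Implicit Types (x y : V) (t u : term V P) (A B : formula V P).

Local Notation I := (@TCapId V P).
Local Notation C := (@TCapComid V P).
Local Notation "A ==> B" := (FImp A B).
Local Notation "A <==> B" := (FIff A B) (at level 57, no associativity).
Local Notation "\box_( t ) A" := (FBox t A)
  (at level 50, t at level 60, A at level 50).
Local Notation "\dia_( t ) A" := (FDia t A)
  (at level 50, t at level 60, A at level 50).
Local Notation "t ;; u" := (TSeq t u) (at level 45, right associativity).
Local Notation "t :+: u" := (TAlt t u) (at level 47, left associativity).

(* The PDL schemata are written with countably many term and formula variables
   of their own, so that the set of axioms is the expected one even when V or P
   is finite; for infinite V and P, schemata over V and P have the same
   instances. *)
Inductive base_axiom : formula V P -> Prop :=
  | Ax_PDL (A : formula nat nat) (s : nat -> term V P) (r : nat -> formula V P) :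
      is_pdl A -> valid_kripke A -> base_axiom (fsubst s r A)
  | Ax_anti t A : base_axiom (\box_(TAnti t) A <==> \box_(TTest (\box_(t) FBot)) A)
  | Ax_id_test t A : base_axiom (\box_(I t) A <==> \box_(TTest (\dia_(I t) FTop)) A)
  | Ax_id_seq t u A : base_axiom (\box_(I (t ;; u)) A <==> \box_(I t ;; I u) A)
  | Ax_id_alt t u A : base_axiom (\box_(I (t :+: u)) A <==> \box_(I t :+: I u) A)
  | Ax_id_plus t A : base_axiom (\box_(I (TPlus t)) A <==> \box_(I t) A)
  | Ax_id_anti t A : base_axiom (\box_(I (TAnti t)) A <==> \box_(TAnti t) A)
  | Ax_id_id t A : base_axiom (\box_(I (I t)) A <==> \box_(I t) A)
  | Ax_id_comid t A : base_axiom (\box_(I (C t)) A <==> FTop)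
  | Ax_id_of_test B A : base_axiom (\box_(I (TTest B)) A <==> \box_(TTest B) A)
  | Ax_comid_split t A : base_axiom (\box_(t) A <==> \box_(I t :+: C t) A)
  | Ax_comid_seq t u A :
      base_axiom (\box_(C (t ;; u)) A
                  <==> \box_((C t ;; I u) :+: (I t ;; C u) :+: (C t ;; C u)) A)
  | Ax_comid_alt t u A : base_axiom (\box_(C (t :+: u)) A <==> \box_(C t :+: C u) A)
  | Ax_comid_plus t A : base_axiom (\box_(C (TPlus t)) A <==> \box_(TPlus (C t)) A)
  | Ax_comid_anti t A : base_axiom (\box_(C (TAnti t)) A <==> FTop)
  | Ax_comid_id t A : base_axiom (\box_(C (I t)) A <==> FTop)
  | Ax_comid_comid t A : base_axiom (\box_(C (C t)) A <==> \box_(C t) A)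
  | Ax_comid_test B A : base_axiom (\box_(C (TTest B)) A <==> FTop)
  | Ax_Loeb t A :
      base_axiom (\box_(TPlus (C t)) (\box_(TPlus (C t)) A ==> A) ==> \box_(TPlus (C t)) A).

Inductive string_axiom : formula V P -> Prop :=
  | Ax_var_irrefl x : string_axiom (\dia_(I (TVar x)) FTop <==> FBot)
  | Ax_var_det x A : string_axiom (\dia_(TVar x) A ==> \box_(TVar x) A)
  | Ax_var_label x y A B :
      x <> y -> string_axiom (\dia_(TVar x) A ==> \box_(TVar y) B).

Inductive derivable (Ax : formula V P -> Prop) : formula V P -> Prop :=
  | D_ax A : Ax A -> derivable Ax A
  | D_mp A B : derivable Ax A -> derivable Ax (A ==> B) -> derivable Ax B
  | D_nec t A : derivable Ax A -> derivable Ax (\box_(t) A).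

Definition string_derivable : formula V P -> Prop :=
  derivable (fun A => base_axiom A \/ string_axiom A).

End Hilbert.

(* Main.v *)
(* Completeness is reduced to a semantic construction. Since every valid PDL
   schema is an axiom, a formula A is derivable as soon as it holds throughout
   every Kripke structure in which finitely many derivable formulas hold
   everywhere, x, t^a, t^{cap id} and t^{cap comid} being read as unrelated
   atomic programs: if U is the union of the atoms, the generated submodel shows
   that [U^*] of these formulas implies A in PDL.

   The cap id and cap comid axioms turn every formula into an equivalent PDL
   formula in which t^+ is only applied to irreflexive terms t. Let such a formula
   fail at a point of a structure satisfying the determinism, label and Loeb axioms
   for the formulas of its Fischer-Ladner closure. Starting there, move to the last
   point of the same type (the set of closure formulas it satisfies), which exists
   by Loeb's axiom, then to a successor, and repeat. No type recurs, so this stops,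
   and the letters read along the way form a string falsifying the formula. *)
From Stdlib Require Import Relation_Operators Operators_Properties.
From HB Require Import structures.
From mathcomp Require Import all_boot boolp.
Require Import Defs.

Set Implicit Arguments.
Unset Strict Implicit.
Unset Printing Implicit Defensive.

Scheme formula_mut := Induction for formula Sort Prop
  with term_mut := Induction for term Sort Prop.
Combined Scheme formula_term_ind from formula_mut, term_mut.

(** Classical equality, so that finite lists of formulas and terms support membership and [index]
    although [V] and [P] are arbitrary types. *)
HB.instance Definition _ (V P : Type) := gen_eqMixin (formula V P).
HB.instance Definition _ (V P : Type) := gen_eqMixin (term V P).

(** * Satisfaction of the derived connectives and the PDL laws for boxes *)

Section SatConnectives.
Variables (V P : Type) (K : kripke V P).
Implicit Types (A B : formula V P) (t u : term V P) (a b : K).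

Lemma sat_and A B a : sat (FAnd A B) a <-> sat A a /\ sat B a.
Proof.
split=> /= [h|[hA hB] h]; last by apply: h.
by split; apply: contrapT => n; apply: h => // hA hB.
Qed.

Lemma sat_iff A B a : sat (FIff A B) a <-> (sat A a <-> sat B a).
Proof. by rewrite sat_and /=; split=> -[]. Qed.

Lemma sat_dia t A a : sat (FDia t A) a <-> exists2 b, trel t a b & sat A b.
Proof.
split=> /= [h|[b tab hA] h]; last exact: h tab hA.
by apply: contrapT => n; apply: h => b tab hA; apply: n; exists b.
Qed.

Lemma sat_box_seq t u A a : sat (FBox (TSeq t u) A) a <-> sat (FBox t (FBox u A)) a.
Proof.
split=> /= h; first by move=> b tab c ubc; apply: h; exists b.
by move=> c [b tab ubc]; apply: h ubc.
Qed.

Lemma sat_box_alt t u A a :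
  sat (FBox (TAlt t u) A) a <-> sat (FBox t A) a /\ sat (FBox u A) a.
Proof.
split=> /= [h|[ht hu] b [/ht|/hu] //].
by split=> b tab; apply: h; [left|right].
Qed.

Lemma sat_box_test A B a : sat (FBox (TTest A) B) a <-> (sat A a -> sat B a).
Proof. by split=> /= [h hA|h b [<- /h]] //; apply: h. Qed.

Lemma sat_box_plus t A a :
  sat (FBox (TPlus t) A) a <->
  forall b, trel t a b -> sat A b /\ sat (FBox (TPlus t) A) b.
Proof.
split=> /= [h b tab|h b tab].
  split=> [|c tbc]; apply: h; first exact: t_step.
  by apply: t_trans tbc; apply: t_step.
case: (clos_trans_t1n _ _ _ _ tab) => [c tac|c d tac tcd].
  by have [] := h _ tac.
by have [_] := h _ tac; apply; apply: clos_t1n_trans.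
Qed.

End SatConnectives.

(** * Substitutions as pullbacks of Kripke structures *)

Section Pullback.
Variables (V P V' P' : Type) (K : kripke V' P').
Variables (s : V -> term V' P') (r : P -> formula V' P').

Definition pull : kripke V P :=
  @Kripke V P K (point_inhabited K) (fun x a b => trel (s x) a b)
    (fun p a => sat (r p) a).

(** Stated as equalities of predicates and relations, not pointwise, so that the induction
    hypotheses rewrite under binders. *)
Lemma sat_trel_pull :
  (forall A, @sat _ _ pull A = @sat _ _ K (fsubst s r A)) /\
  (forall t, @trel _ _ pull t = @trel _ _ K (tsubst s r t)).
Proof.
apply: formula_term_ind => //=.
- by move=> A hA B hB; rewrite hA hB.
- by move=> t ht A hA; rewrite ht hA.
- by move=> t ht u hu; rewrite ht hu.
- by move=> t ht u hu; rewrite ht hu.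
- by move=> t ht; rewrite ht.
- by move=> t ht; rewrite ht.
- by move=> t ht; rewrite ht.
- by move=> t ht; rewrite ht.
- by move=> A hA; rewrite hA.
Qed.

End Pullback.

(** * Generated submodels *)

Section Submodel.
Variables (V P : Type) (K : kripke V P) (D : K -> Prop) (a0 : K).
Hypothesis D0 : D a0.
Hypothesis Drel : forall x a b, D a -> rel_of x a b -> D b.

Definition submodel : kripke V P :=
  @Kripke V P {a | D a} (inhabits (exist _ a0 D0))
    (fun x a b => rel_of x (sval a) (sval b)) (fun p a => val_of p (sval a)).

Lemma trel_closed (t : term V P) a b : D a -> trel t a b -> D b.
Proof.
move=> Da; elim/term_ind: t a b Da => //=.
- by move=> t ht u hu a b Da [c tac]; apply: hu; apply: ht tac.
- by move=> t ht u hu a b Da [/(ht _ _ Da)|/(hu _ _ Da)].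
- move=> t ht a b Da tab; elim: tab Da => [c d tcd Dc|c d e _ h1 _ h2 /h1/h2 //].
  exact: ht Dc tcd.
- by move=> t _ a b Da [<-].
- by move=> t _ a b Da [_ <-].
- by move=> t ht a b Da [/(ht _ _ Da)].
- by move=> A a b Da [<-].
Qed.

Lemma sval_inj (a b : submodel) : sval a = sval b -> a = b.
Proof. by case: a b => a pa [b pb] /= e; subst b; congr exist; apply: Prop_irrelevance. Qed.

(** By [trel_closed] every successor of a point of [D] stays in [D], so boxes, antidomains and
    compositions quantify over the same successors on both sides. *)
Lemma sat_trel_submodel :
  (forall A (a : submodel), sat A a <-> sat A (sval a)) /\
  (forall t (a b : submodel), trel t a b <-> trel t (sval a) (sval b)).
Proof.
apply: formula_term_ind => //=.
- by move=> A hA B hB a; rewrite hA hB.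
- move=> t ht A hA a; split=> h b.
    move=> tab; have Db := trel_closed (svalP a) tab.
    by have /hA := h (exist _ b Db) ((ht a (exist _ b Db)).2 tab).
  by move=> /ht/h/hA.
- move=> t ht u hu a b; split=> [[c /ht tac /hu ucb]|[c tac ucb]].
    by exists (sval c).
  exists (exist _ c (trel_closed (svalP a) tac)); first by apply/ht.
  exact/hu.
- by move=> t ht u hu a b; rewrite ht hu.
- move=> t ht a b; split=> [tab|].
    elim: tab => [c d /ht tcd|c d e _ h1 _ h2]; first exact: t_step.
    exact: t_trans h2.
  (* Points of a path in [K] carry no membership proofs, so the claim is generalized over these
     proofs; closure of [D] under t^+ supplies the one for the midpoint. *)
  have gen c d : clos_trans K (fun a b => trel t a b) c d ->
      forall pc pd, clos_trans submodel (fun a b => trel t a b)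
        (exist _ c pc) (exist _ d pd).
    elim=> [{}c {}d tcd pc pd|{}c d1 {}d h1 IH1 h2 IH2 pc pd].
      by apply: t_step; apply/ht.
    have pd1 : D d1 by apply: (@trel_closed (TPlus t) c).
    exact: t_trans (IH1 pc pd1) (IH2 pd1 pd).
  by case: a b => a pa [b pb] /= /gen.
- move=> t ht a b; split=> -[].
    move=> -> n; split=> // -[c tbc]; apply: n.
    by exists (exist _ c (trel_closed (svalP b) tbc)); apply/ht.
  move=> /sval_inj -> n; split=> // -[c /ht tbc]; apply: n.
  by exists (sval c).
- move=> t ht a b; rewrite ht; split=> -[h e]; split=> //; first by rewrite e.
  exact: sval_inj.
- move=> t ht a b; rewrite ht; split=> -[h n]; split=> // e; apply: n.
    exact: sval_inj.
  by rewrite e.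
- move=> A hA a b; rewrite hA; split=> -[e h]; split=> //; first by rewrite e.
  exact: sval_inj.
Qed.

End Submodel.

(** * Derivability from global premises in structures with opaque atoms *)

Section Opaque.
Variables V P : Type.
Implicit Types (A B : formula V P) (t u : term V P) (L : seq (term V P)) (G : seq (formula V P)).

(** The alphabet becomes the type of terms itself: each variable, antidomain, cap-id or cap-comid
    term is a letter named by itself. *)
Fixpoint oform A : formula (term V P) P :=
  match A with
  | FVar p => FVar p
  | FImp A B => FImp (oform A) (oform B)
  | FBot => FBot
  | FBox t A => FBox (oterm t) (oform A)
  end
with oterm t : term (term V P) P :=
  match t with
  | TSeq t u => TSeq (oterm t) (oterm u)
  | TAlt t u => TAlt (oterm t) (oterm u)
  | TPlus t => TPlus (oterm t)
  | TTest A => TTest (oform A)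
  | _ => TVar t
  end.

Definition opaque t : bool :=
  match t with TSeq _ _ | TAlt _ _ | TPlus _ | TTest _ => false | _ => true end.

(* A formula variable p is recorded as the term p?, so that one list suffices. *)
Fixpoint atoms A : seq (term V P) :=
  match A with
  | FVar p => [:: TTest (FVar p)]
  | FImp A B => atoms A ++ atoms B
  | FBot => [::]
  | FBox t A => term_atoms t ++ atoms A
  end
with term_atoms t : seq (term V P) :=
  match t with
  | TSeq t u | TAlt t u => term_atoms t ++ term_atoms u
  | TPlus t => term_atoms t
  | TTest A => atoms A
  | _ => [:: t]
  end.

Section Encoding.
Variable L : seq (term V P).

(** Letters are numbered by their position in [L]. All other terms receive the empty program F?, so
    that only listed opaque terms have edges in the pulled-back structure. *)
Definition code t : term nat nat :=
  if (t \in L) && opaque t then TVar (index t L) else TTest FBot.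
Definition codep (p : P) : formula nat nat := FVar (index (TTest (FVar p)) L).
Definition decode n : term V P := nth (TTest FBot) L n.
Definition decodep n : formula V P := if decode n is TTest B then B else FBot.

Lemma is_pdl_encoding :
  (forall A, is_pdl (fsubst code codep (oform A))) /\
  (forall t, is_pdl_term (tsubst code codep (oterm t))).
Proof.
apply: formula_term_ind => //=; rewrite /code => *; try by case: ifP.
all: exact/andP.
Qed.

(** Exhibits a formula whose atoms are all listed in [L] as a substitution instance of a PDL formula
    over [nat], the form that [Ax_PDL] demands. *)
Lemma encodingK :
  (forall A, {subset atoms A <= L} ->
     fsubst decode decodep (fsubst code codep (oform A)) = A) /\
  (forall t, {subset term_atoms t <= L} ->
     tsubst decode decodep (tsubst code codep (oterm t)) = t).
Proof.
have sub2 (s1 s2 : seq (term V P)) : {subset s1 ++ s2 <= L} ->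
    {subset s1 <= L} /\ {subset s2 <= L}.
  by move=> h; split=> x xs; apply: h; rewrite mem_cat xs ?orbT.
have sub1 t : {subset [:: t] <= L} -> t \in L by apply; rewrite mem_head.
apply: formula_term_ind => //=.
- by move=> p /sub1 pL; rewrite /decodep /decode nth_index.
- by move=> A hA B hB /sub2[/hA-> /hB->].
- by move=> t ht A hA /sub2[/ht-> /hA->].
- by move=> x /sub1 xL; rewrite /code xL /= /decode nth_index.
- by move=> t ht u hu /sub2[/ht-> /hu->].
- by move=> t ht u hu /sub2[/ht-> /hu->].
- by move=> t ht /ht->.
- by move=> t _ /sub1 tL; rewrite /code tL /= /decode nth_index.
- by move=> t _ /sub1 tL; rewrite /code tL /= /decode nth_index.
- by move=> t _ /sub1 tL; rewrite /code tL /= /decode nth_index.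
- by move=> A hA /hA->.
Qed.

End Encoding.

Definition sum_of L : term V P := foldr (@TAlt V P) (TTest FBot) L.

Lemma trel_sum_of (K : kripke (term V P) P) L (a b : K) :
  trel (oterm (sum_of L)) a b <-> exists2 t, t \in L & trel (oterm t) a b.
Proof.
elim: L => [|t L IH] /=; first by split=> [[]|[]].
rewrite IH; split=> [[tab|[u uL uab]]|[u]].
- by exists t; rewrite // mem_head.
- by exists u; rewrite // in_cons uL orbT.
- by rewrite in_cons => /predU1P[->|uL] uab; [left|right; exists u].
Qed.

Lemma atoms_sum_of L t :
  t \in term_atoms (sum_of [seq t <- L | opaque t]) -> t \in L.
Proof.
elim: L => //= u L IH; rewrite in_cons; case: ifP => [ou|_ /IH ->]; last by rewrite orbT.
rewrite /= mem_cat => /orP[|/IH ->]; last by rewrite orbT.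
by case: u ou => //= ? _; rewrite inE => ->.
Qed.

(** B together with [U^+]B expresses [U^*]B, so this is a local version of the global consequence of
    [A] from [G]. Derivable premises are discharged by necessitation and modus ponens. *)
Definition chain (U : term V P) G A : formula V P :=
  foldr (fun B C => FImp B (FImp (FBox (TPlus U) B) C)) A G.

Lemma sat_chain (K : kripke (term V P) P) U G A (a : K) :
  sat (oform (chain U G A)) a <->
  ((forall B, B \in G -> sat (oform B) a /\ sat (oform (FBox (TPlus U) B)) a) ->
   sat (oform A) a).
Proof.
elim: G => [|B G IH] /=; first by split=> [//|]; apply.
rewrite IH; split=> [h hG|h hB hUB hG].
  have [hB hUB] := hG B (mem_head _ _).
  by apply: h hB hUB _ => C CG; apply: hG; rewrite in_cons CG orbT.
by apply: h => C; rewrite in_cons => /predU1P[->|/hG].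
Qed.

Lemma atoms_chain U G A L :
  {subset term_atoms U <= L} -> {subset atoms A <= L} ->
  (forall B, B \in G -> {subset atoms B <= L}) ->
  {subset atoms (chain U G A) <= L}.
Proof.
move=> hU hA; elim: G => //= B G IH hG t; rewrite !mem_cat.
have hB := hG B (mem_head _ _).
case/or3P=> [/hB //|/orP[/hU|/hB] //|]; apply: IH => C CG.
by apply: hG; rewrite in_cons CG orbT.
Qed.

Lemma base_derivable A : base_axiom A -> string_derivable A.
Proof. by move=> h; apply: D_ax; left. Qed.

Lemma string_axiom_derivable A : string_axiom A -> string_derivable A.
Proof. by move=> h; apply: D_ax; right. Qed.

Lemma chain_derivable U G A :
  (forall B, B \in G -> string_derivable B) -> string_derivable (chain U G A) ->
  string_derivable A.
Proof.
elim: G => //= B G IH hG h; have hB := hG B (mem_head _ _).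
apply: IH => [C CG|]; first by apply: hG; rewrite in_cons CG orbT.
exact: D_mp (D_nec _ hB) (D_mp hB h).
Qed.

(* Only the PDL connectives are interpreted in the models considered here:
   x, t^a, t^{cap id} and t^{cap comid} denote arbitrary relations. *)
Lemma consequence G A :
  (forall B, B \in G -> string_derivable B) ->
  (forall K : kripke (term V P) P,
     (forall B, B \in G -> forall a : K, sat (oform B) a) ->
     forall a : K, sat (oform A) a) ->
  string_derivable A.
Proof.
move=> hG hA; pose L := atoms A ++ flatten (map atoms G).
pose U := sum_of [seq t <- L | opaque t].
have hL : {subset atoms (chain U G A) <= L}.
  apply: atoms_chain => [t|t tA|B BG t tB]; first exact: atoms_sum_of.
    by rewrite mem_cat tA.
  by rewrite mem_cat; apply/orP; right; apply/flattenP; exists (atoms B); rewrite ?map_f.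
apply: (chain_derivable (U := U) hG); apply: base_derivable.
rewrite -((encodingK L).1 _ hL); apply: Ax_PDL; first exact: (is_pdl_encoding L).1.
move=> K a0; rewrite -(sat_trel_pull K (code L) (codep L)).1.
set M := pull _ _ _; rewrite -/M in a0 *; apply/sat_chain => hGa.
(* [D] consists of the points reachable from [a0] by U^*; the premises of the chain make [G] hold
   throughout it. *)
pose D (a : M) := a = a0 \/ clos_trans M (fun a b => trel (oterm U) a b) a0 a.
have Drel (t : term V P) (a b : M) : D a -> rel_of t a b -> D b.
  move=> Da tab; right; suff Uab : trel (oterm U) a b.
    by case: Da => [<-|Da]; [|apply: t_trans Da _]; apply: t_step.
  (* An unlisted letter denotes F? and has no edge; a listed one is a summand of [U]. *)
  move: tab; rewrite /= /code; case: ifP => [/andP[tL ot] tab|_ []//].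
  apply/trel_sum_of; exists t; first by rewrite mem_filter ot.
  by case: t ot tL tab => //= ? _ tL tab; rewrite /code tL.
have D0 : D a0 by left.
pose N := @submodel _ _ M D a0 D0.
have hN B (b : N) := (@sat_trel_submodel _ _ M D a0 D0 Drel).1 (oform B) b.
apply/(hN A (exist _ a0 D0))/hA => B /hGa[hB hUB] b; apply/hN.
by case: b => b /= [->|/hUB].
Qed.

End Opaque.

(** * Provable equivalence as a congruence on formulas and terms *)

Section Equivalence.
Variables V P : Type.
Implicit Types (A B : formula V P) (t u : term V P).

Definition eqv A B := string_derivable (FIff A B).
(** Terms are compared only through their boxes, since this is what the axioms assert. *)
Definition teqv t u := forall A, eqv (FBox t A) (FBox u A).

Lemma eqv_consequence (G : seq (formula V P * formula V P)) A B :
  foldr (fun p => and (eqv p.1 p.2)) True G ->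
  (forall K : kripke (term V P) P,
     foldr (fun p => and (forall a : K, sat (oform p.1) a <-> sat (oform p.2) a))
       True G ->
     forall a : K, sat (oform A) a <-> sat (oform B) a) ->
  eqv A B.
Proof.
move=> hG hAB; apply: (@consequence _ _ [seq FIff p.1 p.2 | p <- G]).
  elim: G hG {hAB} => //= p G IH [hp /IH hG] C.
  by rewrite in_cons => /predU1P[->|/hG].
move=> K hK a; apply/sat_iff; apply: hAB; elim: G {hG} hK => //= p G IH hK.
split=> [b|]; first by apply/sat_iff/(hK (FIff p.1 p.2))/mem_head.
by apply: IH => C CG; apply: hK; rewrite in_cons CG orbT.
Qed.

Lemma eqv_valid A B :
  (forall (K : kripke (term V P) P) (a : K), sat (oform A) a <-> sat (oform B) a) ->
  eqv A B.
Proof. by move=> h; apply: (@eqv_consequence [::]). Qed.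

Lemma eqv_refl A : eqv A A.
Proof. exact: eqv_valid. Qed.

Lemma eqv_sym A B : eqv A B -> eqv B A.
Proof.
move=> h; apply: (@eqv_consequence [:: (_, _)] _ _ (conj h Logic.I)).
by move=> K [hK _] a; rewrite hK.
Qed.

Lemma eqv_trans B A C : eqv A B -> eqv B C -> eqv A C.
Proof.
move=> h1 h2.
apply: (@eqv_consequence [:: (_, _); (_, _)] _ _ (conj h1 (conj h2 Logic.I))).
by move=> K [/= k1 [k2 _]] a; rewrite k1.
Qed.

Lemma eqv_derivable A B : eqv A B -> string_derivable B -> string_derivable A.
Proof.
move=> hAB hB; apply: (@consequence _ _ [:: FIff A B; B]).
  by move=> C; rewrite !inE => /orP[]/eqP->.
move=> K hK a; have /sat_iff hAB' := hK (FIff A B) (mem_head _ _) a.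
by apply/hAB'; apply: (hK B); rewrite !inE eqxx orbT.
Qed.

Lemma eqv_imp A A' B B' : eqv A A' -> eqv B B' -> eqv (FImp A B) (FImp A' B').
Proof.
move=> h1 h2.
apply: (@eqv_consequence [:: (_, _); (_, _)] _ _ (conj h1 (conj h2 Logic.I))).
by move=> K [/= k1 [k2 _]] a; rewrite k1 k2.
Qed.

Lemma eqv_and A A' B B' : eqv A A' -> eqv B B' -> eqv (FAnd A B) (FAnd A' B').
Proof. by move=> hA hB; do !apply: eqv_imp => //; apply: eqv_refl. Qed.

Lemma eqv_box t u A B : teqv t u -> eqv A B -> eqv (FBox t A) (FBox u B).
Proof.
move=> htu hAB; apply: (eqv_trans (htu A)).
apply: (@eqv_consequence [:: (_, _)] _ _ (conj hAB Logic.I)).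
by move=> K [hK _] a /=; split=> h b /h/hK.
Qed.

Lemma teqv_refl t : teqv t t.
Proof. by move=> A; apply: eqv_refl. Qed.

Lemma teqv_sym t u : teqv t u -> teqv u t.
Proof. by move=> h A; apply: eqv_sym. Qed.

Lemma teqv_trans u t v : teqv t u -> teqv u v -> teqv t v.
Proof. by move=> h1 h2 A; apply: eqv_trans (h1 A) (h2 A). Qed.

Lemma teqv_valid t u :
  (forall (K : kripke (term V P) P) (a b : K), trel (oterm t) a b <-> trel (oterm u) a b) ->
  teqv t u.
Proof. by move=> h A; apply: eqv_valid => K a; split=> hA b /h/hA. Qed.

Lemma teqv_seq t t' u u' : teqv t t' -> teqv u u' -> teqv (TSeq t u) (TSeq t' u').
Proof.
move=> ht hu A; have h := eqv_box ht (hu A).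
apply: (@eqv_consequence [:: (_, _)] _ _ (conj h Logic.I)).
by move=> K [hK _] a; split=> /sat_box_seq h'; apply/sat_box_seq; apply/hK.
Qed.

Lemma teqv_alt t t' u u' : teqv t t' -> teqv u u' -> teqv (TAlt t u) (TAlt t' u').
Proof.
move=> ht hu A.
apply: (@eqv_consequence [:: (_, _); (_, _)] _ _ (conj (ht A) (conj (hu A) Logic.I))).
move=> K [/= k1 [k2 _]] a.
by split=> /sat_box_alt[/k1 h1 /k2 h2]; apply/sat_box_alt.
Qed.

(** Finitely many instances of the hypothesis suffice: those at A, [t^+]A and [u^+]A. The formula
    [t^+]A is an invariant along u-paths, and [u^+]A along t-paths. *)
Lemma teqv_plus t u : teqv t u -> teqv (TPlus t) (TPlus u).
Proof.
move=> htu A; set B := FBox (TPlus t) A; set C := FBox (TPlus u) A.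
have h := conj (htu A) (conj (htu B) (conj (htu C) Logic.I)).
apply: (@eqv_consequence [:: (_, _); (_, _); (_, _)] _ _ h).
have gen (K : kripke (term V P) P) (t' u' : term (term V P) P)
    (A' : formula (term V P) P) :
    (forall a : K, sat (FBox t' A') a -> sat (FBox u' A') a) ->
    (forall a : K, sat (FBox t' (FBox (TPlus t') A')) a ->
                   sat (FBox u' (FBox (TPlus t') A')) a) ->
    forall a : K, sat (FBox (TPlus t') A') a -> sat (FBox (TPlus u') A') a.
  move=> h1 h2 a ha b uab; elim: (clos_trans_t1n _ _ _ _ uab) ha => [c d ucd|c d e ucd _ IH].
    move/sat_box_plus=> hc; apply: (h1 c) ucd => e tce.
    by have [] := hc _ tce.
  move/sat_box_plus=> hc; apply: IH; apply: (h2 c) ucd => f tcf.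
  by have [] := hc _ tcf.
move=> K [/= k1 [k2 [k3 _]]] a; split; apply: gen => b.
- by move/k1.
- by move/k2.
- by move/k1.
- by move/k3.
Qed.

Lemma teqv_test A B : eqv A B -> teqv (TTest A) (TTest B).
Proof.
move=> hAB C; apply: (@eqv_consequence [:: (_, _)] _ _ (conj hAB Logic.I)).
by move=> K [hK _] a; split=> /sat_box_test h; apply/sat_box_test => /hK.
Qed.

Lemma eqv_axiom A B : base_axiom (FIff A B) -> eqv A B.
Proof. exact: base_derivable. Qed.

End Equivalence.

(** * Elimination of antidomain, cap id and cap comid *)

Section NormalForm.
Variables V P : Type.
Implicit Types (A B : formula V P) (t u : term V P).

Definition FOr A B := FImp (FNeg A) B.
Definition TZero : term V P := TTest FBot.

(* t^{cap id} is equivalent to (id_part t)? and t^{cap comid} to strict_part t. *)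
Fixpoint nf A : formula V P :=
  match A with
  | FVar p => FVar p
  | FImp A B => FImp (nf A) (nf B)
  | FBot => FBot
  | FBox t A => FAnd (FImp (id_part t) (nf A)) (FBox (strict_part t) (nf A))
  end
with id_part t : formula V P :=
  match t with
  | TVar _ => FBot
  | TSeq t u => FAnd (id_part t) (id_part u)
  | TAlt t u => FOr (id_part t) (id_part u)
  | TPlus t => id_part t
  | TAnti t => FAnd (FImp (id_part t) FBot) (FBox (strict_part t) FBot)
  | TCapId t => id_part t
  | TCapComid _ => FBot
  | TTest A => nf A
  end
with strict_part t : term V P :=
  match t with
  | TVar x => TVar x
  | TSeq t u =>
      TAlt (TAlt (TSeq (strict_part t) (TTest (id_part u)))
                 (TSeq (TTest (id_part t)) (strict_part u)))
           (TSeq (strict_part t) (strict_part u))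
  | TAlt t u => TAlt (strict_part t) (strict_part u)
  | TPlus t => TPlus (strict_part t)
  | TAnti _ => TZero
  | TCapId _ => TZero
  | TCapComid t => strict_part t
  | TTest _ => TZero
  end.

Lemma teqv_zero t : (forall A, base_axiom (FIff (FBox t A) FTop)) -> teqv t TZero.
Proof.
move=> h A; apply: eqv_trans (eqv_axiom (h A)) _.
by apply: eqv_valid => K a; split=> [_ b [_ []]|_]; apply: id.
Qed.

Lemma teqv_split t : teqv t (TAlt (TCapId t) (TCapComid t)).
Proof. by move=> A; apply: eqv_axiom; apply: Ax_comid_split. Qed.

Lemma eqv_box_split t A B u :
  teqv (TCapId t) (TTest A) -> teqv (TCapComid t) u ->
  eqv (FBox t B) (FAnd (FImp A B) (FBox u B)).
Proof.
move=> ht hu; apply: eqv_trans (teqv_trans (teqv_split t) (teqv_alt ht hu) B) _.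
apply: eqv_valid => K a.
by split=> [/sat_box_alt[/sat_box_test h1 h2]|/sat_and[h1 h2]];
  [apply/sat_and|apply/sat_box_alt; split=> //; apply/sat_box_test].
Qed.

Lemma nf_correct :
  (forall A, eqv A (nf A)) /\
  (forall t, teqv (TCapId t) (TTest (id_part t)) /\ teqv (TCapComid t) (strict_part t)).
Proof.
apply: formula_term_ind => /=.
- by move=> p; apply: eqv_refl.
- by move=> A hA B hB; apply: eqv_imp.
- exact: eqv_refl.
- move=> t [hI hC] A hA; apply: eqv_trans (eqv_box_split A hI hC) _.
  apply: eqv_and; first by apply: eqv_imp => //; apply: eqv_refl.
  by apply: eqv_box => //; apply: teqv_refl.
(* The irreflexivity axiom makes the identity part of x empty, and the splitting axiom then
   identifies x with its cap-comid part. *)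
- move=> x; have hI : teqv (TCapId (TVar x)) TZero.
    apply: (@teqv_trans _ _ (TTest (FDia (TCapId (TVar x)) FTop))).
      by move=> A; apply: eqv_axiom; apply: Ax_id_test.
    by apply: teqv_test; apply: string_axiom_derivable; apply: Ax_var_irrefl.
  split=> //; apply: teqv_sym; apply: teqv_trans (teqv_split _) _.
  apply: teqv_trans (teqv_alt hI (teqv_refl _)) _.
  by apply: teqv_valid => K a b /=; split=> [[[_ []]|]|]; [|right].
- move=> t [htI htC] u [huI huC]; split.
    apply: (@teqv_trans _ _ (TSeq (TCapId t) (TCapId u))).
      by move=> A; apply: eqv_axiom; apply: Ax_id_seq.
    apply: teqv_trans (teqv_seq htI huI) _; apply: teqv_valid => K a b.
    split=> [[c [<- ha] [<- hb]]|[<- /sat_and[ha hb]]]; last by exists a.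
    by split=> //; apply/sat_and.
  apply: (@teqv_trans _ _ (TAlt (TAlt (TSeq (TCapComid t) (TCapId u))
    (TSeq (TCapId t) (TCapComid u))) (TSeq (TCapComid t) (TCapComid u)))).
    by move=> A; apply: eqv_axiom; apply: Ax_comid_seq.
  by do !apply: teqv_alt; apply: teqv_seq.
- move=> t [htI htC] u [huI huC]; split.
    apply: (@teqv_trans _ _ (TAlt (TCapId t) (TCapId u))).
      by move=> A; apply: eqv_axiom; apply: Ax_id_alt.
    apply: teqv_trans (teqv_alt htI huI) _; apply: teqv_valid => K a b /=.
    split=> [[[<- h]|[<- h]]|[<- h]] //.
    by have [ha|ha] := EM (sat (oform (id_part t)) a); [left|right; split=> //; apply: h].
  apply: teqv_trans (teqv_alt htC huC).
  by move=> A; apply: eqv_axiom; apply: Ax_comid_alt.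
- move=> t [hI hC]; split.
    by apply: teqv_trans hI => A; apply: eqv_axiom; apply: Ax_id_plus.
  apply: teqv_trans (teqv_plus hC).
  by move=> A; apply: eqv_axiom; apply: Ax_comid_plus.
- move=> t [hI hC]; split.
    (* The identity part of t^a is t^a itself, which is the test of [t]F; splitting [t] in [t]F
       yields [id_part]. *)
    apply: (@teqv_trans _ _ (TTest (FBox t FBot))); last first.
      exact: teqv_test (eqv_box_split _ hI hC).
    apply: (@teqv_trans _ _ (TAnti t)) => A; apply: eqv_axiom.
      exact: Ax_id_anti.
    exact: Ax_anti.
  by apply: teqv_zero => A; apply: Ax_comid_anti.
- move=> t [hI hC]; split.
    by apply: teqv_trans hI => A; apply: eqv_axiom; apply: Ax_id_id.
  by apply: teqv_zero => A; apply: Ax_comid_id.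
- move=> t [hI hC]; split.
    by apply: teqv_zero => A; apply: Ax_id_comid.
  by apply: teqv_trans hC => A; apply: eqv_axiom; apply: Ax_comid_comid.
- move=> A hA; split; last by apply: teqv_zero => B; apply: Ax_comid_test.
  apply: teqv_trans (teqv_test hA).
  by move=> B; apply: eqv_axiom; apply: Ax_id_of_test.
Qed.

Fixpoint strict t : bool :=
  match t with
  | TVar _ => true
  | TSeq t u => strict t || strict u
  | TAlt t u => strict t && strict u
  | TPlus t => strict t
  | TTest FBot => true
  | _ => false
  end.

(* Iterated terms must be strict: in the truth lemma an eventuality of t^+ is
   fulfilled because every t-step moves forward in the finite string. *)
Fixpoint normal A : bool :=
  match A with
  | FVar _ | FBot => true
  | FImp A B => normal A && normal B
  | FBox t A => term_normal t && normal A
  end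
with term_normal t : bool :=
  match t with
  | TVar _ => true
  | TSeq t u | TAlt t u => term_normal t && term_normal u
  | TPlus t => strict t && term_normal t
  | TTest A => normal A
  | TAnti _ | TCapId _ | TCapComid _ => false
  end.

Lemma nf_normal :
  (forall A, normal (nf A)) /\
  (forall t, [/\ normal (id_part t), term_normal (strict_part t) & strict (strict_part t)]).
Proof.
apply: formula_term_ind => //=.
- by move=> A -> B ->.
- by move=> t [-> -> _] A ->.
- by move=> t [-> -> ->] u [-> -> ->]; rewrite orbT.
- by move=> t [-> -> ->] u [-> -> ->].
- by move=> t [-> -> ->].
- by move=> t [-> -> _].
- by move=> t [-> _ _].
- by move=> t [_ -> ->].
Qed.

End NormalForm.

(** * Soundness, over structures ranked by a bounded natural number *)

Section Soundness.
Variables (V P : Type) (K : kripke V P) (f : K -> nat) (n : nat).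
(** The rank stands for the position in the string: a bounded rank that grows along letters is the
    form in which finiteness and order are used. *)
Hypothesis f_le : forall a, f a <= n.
Hypothesis rel_lt : forall x (a b : K), rel_of x a b -> f a < f b.
Implicit Types (A B : formula V P) (t u : term V P) (a b c : K).

Lemma trel_rank t a b : trel t a b -> a = b \/ f a < f b.
Proof.
elim/term_ind: t a b => /=.
- by move=> x a b /rel_lt; right.
- move=> t ht u hu a b [c /ht[<-|lac] /hu[<-|lcb]]; [by left|by right|by right|].
  by right; apply: ltn_trans lcb.
- by move=> t ht u hu a b [/ht|/hu].
- move=> t ht a b tab; elim: tab => [c d /ht //|c d e _ [<-|lcd] _ [<-|lde]];
    [by left|by right|by right|right].
  exact: ltn_trans lde.
- by move=> t _ a b [-> _]; left.
- by move=> t _ a b [_ ->]; left.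
- by move=> t ht a b [/ht].
- by move=> A a b [-> _]; left.
Qed.

Lemma trel_antisym t u a b : trel t a b -> trel u b a -> a = b.
Proof.
move=> /trel_rank[//|lab] /trel_rank[//|lba].
by have := ltn_trans lab lba; rewrite ltnn.
Qed.

(** One strict factor is enough in a composition, because no term lowers the rank. The truth lemma
    applies this again to the string that it builds. *)
Lemma trel_lt t a b : strict t -> trel t a b -> f a < f b.
Proof.
elim/term_ind: t a b => //=.
- by move=> x a b _; apply: rel_lt.
- move=> t ht u hu a b s [c tac ucb]; case/orP: s => s.
    by have [<-|] := trel_rank ucb; [apply: ht|apply: ltn_trans (ht _ _ s tac)].
  have lcb := hu _ _ s ucb.
  by have [->//|lac] := trel_rank tac; apply: ltn_trans lcb.
- by move=> t ht u hu a b /andP[st su] [/(ht _ _ st)|/(hu _ _ su)].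
- move=> t ht a b s tab; elim: tab => [c d /(ht _ _ s)|c d e _ lcd _ lde] //.
  exact: ltn_trans lde.
- by case=> // a b _ [_].
Qed.

Lemma comid_plus_lt t a b : trel (TPlus (TCapComid t)) a b -> f a < f b.
Proof.
elim=> [c d [/trel_rank[]]//|c d e _ lcd _ lde].
exact: ltn_trans lde.
Qed.

Lemma trel_comid_plus t a b :
  trel (TCapComid (TPlus t)) a b <-> trel (TPlus (TCapComid t)) a b.
Proof.
split=> [[/= tab]|tab].
  elim: tab => [c d tcd ncd|c d e _ IH1 _ IH2 nce]; first exact: t_step.
  have [ecd|ncd] := EM (c = d); first by subst d; apply: IH2.
  have [ede|nde] := EM (d = e); first by subst e; apply: IH1.
  exact: t_trans (IH1 ncd) (IH2 nde).
split; last by move=> e; have := comid_plus_lt tab; rewrite e ltnn.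
by elim: tab => [c d [tcd _]|c d e _ h1 _ h2]; [apply: t_step|apply: t_trans h2].
Qed.

(** On a t-cycle the first step already ends at its start, by antisymmetry. *)
Lemma trel_id_plus t a b : trel (TCapId (TPlus t)) a b <-> trel (TCapId t) a b.
Proof.
split=> /= -[tab ab]; split=> //; last exact: t_step.
case: (clos_trans_t1n _ _ _ _ tab) ab => [//|c d tac tcd] ad; subst d.
have tca : trel (TPlus t) c a by apply: clos_t1n_trans.
by rewrite {2}(trel_antisym tac tca).
Qed.

Lemma sat_box_ext t u A a :
  (forall b, trel t a b <-> trel u a b) -> sat (FBox t A) a <-> sat (FBox u A) a.
Proof. by move=> h; split=> hA b /h/hA. Qed.

Lemma sat_box_empty t A a : (forall b, ~ trel t a b) -> sat (FBox t A) a <-> sat (@FTop V P) a.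
Proof. by move=> h; split=> [_|_ b /h] //; apply: id. Qed.

Lemma sat_base_axiom A a : base_axiom A -> sat A a.
Proof.
case=> {A}.
- by move=> A s r _ hA; rewrite -(sat_trel_pull K s r).1; apply: hA.
- move=> t A; apply/sat_iff/sat_box_ext => b /=.
  split=> -[-> h]; split=> //; first by move=> c tbc; apply: h; exists c.
  by case=> c /h.
- move=> t A; apply/sat_iff/sat_box_ext => b /=.
  split=> [[tab e]|[<- h]].
    by subst b; split=> // h; exact: h a (conj tab erefl) id.
  by split=> //; apply: contrapT => m; apply: h => c [tac e]; subst c.
- move=> t u A; apply/sat_iff/sat_box_ext => b /=; split.
    move=> [[c tac ucb] e]; subst b; have e := trel_antisym tac ucb; subst c.
    by exists a.
  by move=> [c [tac ac] [ucb cb]]; subst b c; split=> //; exists a.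
- by move=> t u A; apply/sat_iff/sat_box_ext => b /=; tauto.
- by move=> t A; apply/sat_iff/sat_box_ext => b; apply: trel_id_plus.
- by move=> t A; apply/sat_iff/sat_box_ext => b /=; tauto.
- by move=> t A; apply/sat_iff/sat_box_ext => b /=; tauto.
- by move=> t A; apply/sat_iff/sat_box_empty => b /= [[]].
- by move=> B A; apply/sat_iff/sat_box_ext => b /=; tauto.
- move=> t A; apply/sat_iff/sat_box_ext => b /=; split=> [tab|[[]|[]]//].
  by have [ab|ab] := EM (a = b); [left|right].
- move=> t u A; apply/sat_iff/sat_box_ext => b /=; split.
    move=> [[c tac ucb] nab].
    have [ac|nac] := EM (a = c); have [cb|ncb] := EM (c = b).
    + by case: nab; rewrite ac.
    + by left; right; exists c.
    + by left; left; exists c.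
    + by right; exists c.
  (* If the composition returned to [a], antisymmetry would make its first step stationary. *)
  have comid_neq c : trel (TCapComid t) a c -> trel u c b -> a <> b.
    by move=> [tac nac] ucb ab; subst b; apply: nac (trel_antisym tac ucb).
  move=> [[]|] [c tac ucb]; split.
  + by exists c; [case: tac|case: ucb].
  + by apply: comid_neq tac _; case: ucb.
  + by exists c; [case: tac|case: ucb].
  + by case: tac ucb => _ -> [].
  + by exists c; [case: tac|case: ucb].
  + by apply: comid_neq tac _; case: ucb.
- by move=> t u A; apply/sat_iff/sat_box_ext => b /=; tauto.
- by move=> t A; apply/sat_iff/sat_box_ext => b; apply: trel_comid_plus.
- by move=> t A; apply/sat_iff/sat_box_empty => b /= [[]].
- by move=> t A; apply/sat_iff/sat_box_empty => b /= [[]].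
- by move=> t A; apply/sat_iff/sat_box_ext => b /=; tauto.
- by move=> B A; apply/sat_iff/sat_box_empty => b /= [[]].
(* Induction on a bound for the distance of [f b] from [n]: at distance 0 no proper step leaves [b],
   and each proper step decreases the distance. *)
- move=> t A hA b tab; move: {2}(n - f b) (leqnn (n - f b)) => k.
  elim: k b tab => [|k IH] b tab lek; apply: hA => // c tbc.
    have := comid_plus_lt tbc; rewrite ltnNge; case/negP.
    by apply: leq_trans (f_le c) _; rewrite -subn_eq0 -leqn0.
  apply: IH; first exact: t_trans tbc.
  rewrite -ltnS; apply: leq_trans lek; apply: ltn_sub2l; last exact: comid_plus_lt tbc.
  exact: leq_trans (comid_plus_lt tbc) (f_le c).
Qed.

Hypothesis rel_fun : forall x a b c, rel_of x a b -> rel_of x a c -> b = c.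
Hypothesis rel_label : forall x y a b c, rel_of x a b -> rel_of y a c -> x = y.

Lemma sat_string_axiom A a : string_axiom A -> sat A a.
Proof.
case=> {A}.
- move=> x; apply/sat_iff; split=> // /sat_dia[b /= [ab e] _]; subst b.
  by have := rel_lt ab; rewrite ltnn.
- move=> x A h c ac; have /sat_dia[b ab hb] : sat (FDia (TVar x) A) a := h.
  by rewrite -(rel_fun ab ac).
- move=> x y A B nxy h c ac; have /sat_dia[b ab _] : sat (FDia (TVar x) A) a := h.
  by case: nxy; apply: rel_label ab ac.
Qed.

Lemma sat_derivable A : string_derivable A -> forall a, sat A a.
Proof.
elim=> [{}A [hA|hA] a|{}A B _ hA _ hAB a|t {}A _ hA a b _] //.
- exact: sat_base_axiom.
- exact: sat_string_axiom.
- exact: hAB a (hA a).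
- exact: hA b.
Qed.

End Soundness.

Lemma soundness (V P : Type) (A : formula V P) :
  string_derivable A -> valid_on (@string_class V P) A.
Proof.
move=> hA S [w [g [[h gK _] _ grel _]]] a.
(* The isomorphism starts from [clear_vars S], but [S] has the same letters, so string positions
   rank [S] under any valuation. *)
pose f (b : S) : nat := g b : 'I_(size w).+1.
have frel x (b c : S) : rel_of x b c -> f c = (f b).+1 /\ onth w (f b) = Some x.
  by move=> /grel.
apply: (@sat_derivable _ _ S f (size w) _ _ _ _ A hA a).
- by move=> b; rewrite -ltnS; apply: ltn_ord.
- by move=> x b c /frel[->].
- move=> x b c d /frel[ec _] /frel[ed _].
  by apply: (can_inj gK); apply/val_inj; rewrite [LHS]ec [RHS]ed.
- by move=> x y b c d /frel[_ ex] /frel[_ ey]; move: ey; rewrite ex => -[].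
Qed.

(** * Fischer-Ladner closure, types and the finite theory of strings *)

Section FischerLadner.
Variables V P : Type.
Implicit Types (A B c : formula V P) (t u : term V P) (cl : seq (formula V P)).

(** The Fischer-Ladner closure. [term_closure t B] lists the boxes that arise when [t]B is unfolded,
    [t^+]B giving [t]B and [t][t^+]B; the subformulas of [B] are left to the caller. *)
Fixpoint closure A : seq (formula V P) :=
  A :: match A with
       | FImp A B => closure A ++ closure B
       | FBox t A => term_closure t A ++ closure A
       | _ => [::]
       end
with term_closure t B : seq (formula V P) :=
  FBox t B :: match t with
              | TSeq t u => term_closure t (FBox u B) ++ term_closure u B
              | TAlt t u => term_closure t B ++ term_closure u B
              | TPlus t => term_closure t B ++ term_closure t (FBox (TPlus t) B)
              | TTest A => closure A
              | _ => [::]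
              end.

(** The characteristic formulas of the types over [cl], one for each choice of signs. *)
Fixpoint chars cl : seq (formula V P) :=
  if cl is A :: cl then
    [seq FAnd A c | c <- chars cl] ++ [seq FAnd (FNeg A) c | c <- chars cl]
  else [:: FTop].

Definition agree (K : kripke (term V P) P) cl (a b : K) :=
  forall A, A \in cl -> sat (oform A) a <-> sat (oform A) b.

Lemma chars_exists (K : kripke (term V P) P) cl (a : K) :
  exists2 c, c \in chars cl & sat (oform c) a.
Proof.
elim: cl => [|A cl [c hc ha]] /=; first by exists FTop; rewrite ?mem_head.
have [hA|hA] := EM (sat (oform A) a).
  exists (FAnd A c); first by rewrite mem_cat map_f.
  by apply/sat_and.
exists (FAnd (FNeg A) c); first by rewrite mem_cat map_f ?orbT.
by apply/sat_and.
Qed.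

Lemma chars_agree (K : kripke (term V P) P) cl c (a b : K) :
  c \in chars cl -> sat (oform c) a -> sat (oform c) b -> agree cl a b.
Proof.
elim: cl c => [//|A cl IH] c /=.
rewrite mem_cat => /orP[]/mapP[d hd ->] /sat_and[hA1 ha] /sat_and[hA2 hb] B;
  rewrite in_cons => /predU1P[->|]; try exact: IH hd ha hb B.
  by [].
by split=> [/hA1|/hA2].
Qed.

Definition box_letter A : option (term V P) :=
  if A is FBox (TVar x) _ then Some (TVar x) else None.

Definition letters cl : seq (term V P) := pmap box_letter cl.

Lemma mem_letters cl x B : FBox (TVar x) B \in cl -> TVar x \in letters cl.
Proof. by move=> h; rewrite mem_pmap; apply/mapP; exists (FBox (TVar x) B). Qed.

Lemma lettersP cl t : t \in letters cl -> exists x, t = TVar x.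
Proof.
rewrite mem_pmap => /mapP[[]// [] //= x A _ [->]].
by exists x.
Qed.

(* FTop is a dummy axiom, for the formulas A that are not boxes of a letter. *)
Definition det_axiom A : formula V P :=
  if A is FBox (TVar x) B then
    FImp (FDia (TVar x) (FNeg B)) (FBox (TVar x) (FNeg B))
  else FTop.

Definition label_axiom t u : formula V P :=
  if t == u then FTop else FImp (FDia t FTop) (FBox u FBot).

Definition loeb_axiom t A : formula V P :=
  FImp (FBox (TPlus t) (FImp (FBox (TPlus t) A) A)) (FBox (TPlus t) A).

(** The finitely many axiom instances behind the construction. Loeb is taken for one step by any
    relevant letter and for negated types, which gives last realizers. *)
Definition string_theory cl : seq (formula V P) :=
  [seq det_axiom A | A <- cl] ++
  [seq label_axiom t u | t <- letters cl, u <- letters cl] ++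
  [seq loeb_axiom (sum_of (letters cl)) (FNeg c) | c <- chars cl].

Lemma top_derivable : string_derivable (@FTop V P).
Proof. by apply: (@consequence _ _ [::]) => // K _ a; apply: id. Qed.

Lemma det_derivable A : string_derivable (det_axiom A).
Proof.
case: A => /= [p|A B||t A]; try exact: top_derivable.
case: t; try by move=> *; apply: top_derivable.
by move=> x; apply: string_axiom_derivable; apply: Ax_var_det.
Qed.

Lemma label_derivable x y : string_derivable (label_axiom (TVar x) (TVar y)).
Proof.
rewrite /label_axiom; case: eqP => [_|n]; first exact: top_derivable.
by apply: string_axiom_derivable; apply: Ax_var_label => e; apply: n; rewrite e.
Qed.

Lemma loeb_derivable t A : teqv (TCapComid t) t -> string_derivable (loeb_axiom t A).
Proof.
move=> h; have hp := teqv_plus h; apply: (eqv_derivable (eqv_sym _)).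
  apply: (@eqv_imp _ _ (FBox (TPlus (TCapComid t)) (FImp (FBox (TPlus (TCapComid t)) A) A)));
    apply: eqv_box => //; last exact: eqv_refl.
  by apply: eqv_imp; [apply: hp|apply: eqv_refl].
by apply: base_derivable; apply: Ax_Loeb.
Qed.

(** With [nf_correct] this makes a sum of letters equivalent to its cap-comid part, so that Loeb's
    axiom applies to the sum itself. *)
Lemma strict_part_letters cl :
  strict_part (sum_of (letters cl)) = sum_of (letters cl).
Proof.
have: forall t, t \in letters cl -> strict_part t = t.
  by move=> t /lettersP[x ->].
elim: (letters cl) => //= t L IH h; rewrite h ?mem_head // IH // => u uL.
by apply: h; rewrite in_cons uL orbT.
Qed.

Lemma string_theory_derivable cl A :
  A \in string_theory cl -> string_derivable A.
Proof.
rewrite !mem_cat => /or3P[/mapP[B _ ->]|/allpairsP[[t u] /= [ht hu ->]]|/mapP[c _ ->]].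
- exact: det_derivable.
- have [x ->] := lettersP ht; have [y ->] := lettersP hu.
  exact: label_derivable.
- apply: loeb_derivable; rewrite -[X in teqv _ X]strict_part_letters.
  exact: ((nf_correct V P).2 _).2.
Qed.

(** * Runs through last realizers of types *)

Section Run.
Variables (K : kripke (term V P) P) (cl : seq (formula V P)).
Hypothesis theory : forall A, A \in string_theory cl -> forall a : K, sat (oform A) a.
Implicit Types (a b : K) (s : seq (V * K)).

Let step a b := trel (oterm (sum_of (letters cl))) a b.

Lemma stepP a b :
  step a b <-> exists2 x, TVar x \in letters cl & @rel_of _ _ K (TVar x) a b.
Proof.
rewrite /step trel_sum_of; split=> [[t tL]|[x xL ab]]; last by exists (TVar x).
by have [x et] := lettersP tL; subst t; exists x.
Qed.

(* The Loeb axiom for ~ c gives a last point satisfying c. *)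
Lemma last_realizer c a :
  c \in chars cl -> sat (oform c) a ->
  exists b, [/\ a = b \/ clos_trans K step a b, sat (oform c) b &
                forall d, clos_trans K step b d -> ~ sat (oform c) d].
Proof.
move=> hc ha; have hL : loeb_axiom (sum_of (letters cl)) (FNeg c) \in string_theory cl.
  by rewrite !mem_cat (map_f (fun c => loeb_axiom _ (FNeg c))) ?orbT.
have hloeb := theory hL; apply: contrapT => n.
apply: (n); exists a; split=> //; first by left.
move=> d; apply: (hloeb a) => {}d ad hd cd.
by apply: n; exists d; split=> //; right.
Qed.

(* Consecutive points of a run are linked by a letter only up to agreement on
   cl: the target of an edge is replaced by the last realizer of its type. *)
Fixpoint run a s : Prop :=
  if s is (x, b) :: s then
    [/\ TVar x \in letters cl,
        exists2 b', @rel_of _ _ K (TVar x) a b' & agree cl b' b & run b s]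
  else forall b, ~ step a b.

Lemma run_exists a : exists b s, agree cl a b /\ run b s.
Proof.
pose reach a b := a = b \/ clos_trans K step a b.
(* The list [l] covers the types still realized at or beyond [b]; the induction is on its length. *)
suff gen (l : seq (formula V P)) b :
    (forall d, reach b d -> exists c, [/\ c \in l, c \in chars cl & sat (oform c) d]) ->
    exists b' s, agree cl b b' /\ run b' s.
  apply: (gen (chars cl)) => d _; have [c hc hd] := chars_exists cl d.
  by exists c.
move: {2}(size l) (leqnn (size l)) => n.
elim: n l b => [|n IH] l b hl hb; have [c [cl_ hc hcb]] := hb b (or_introl erefl).
  by move: hl cl_; rewrite leqn0 => /nilP->.
have [d [bd hd hlast]] := last_realizer hc hcb; have bd_agree := chars_agree hc hcb hd.
have [[e /[dup] de /stepP[x xL xde]]|none] := EM (exists e, step d e); last first.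
  by exists d, [::]; split=> // e de; apply: none; exists e.
have de_reach g : reach e g -> clos_trans K step d g.
  by case=> [<-|eg]; [|apply: t_trans eg]; apply: t_step.
(* No point beyond [d] realizes [c], so [c] is deleted and the run continues from the successor
   [e]. *)
have [||e' [s [ee' he']]] := IH [seq c' <- l | c' != c] e.
- rewrite -ltnS; apply: leq_trans hl; rewrite size_filter.
  rewrite -(count_predC (predC1 c)) -addn1 leq_add2l -has_count.
  by apply/hasP; exists c => //=; rewrite negbK.
- move=> g eg; have dg := de_reach _ eg.
  have [|c' [c'l hc' hg]] := hb g.
    by right; case: bd => [->//|bd]; apply: t_trans dg.
  exists c'; split=> //; rewrite mem_filter c'l andbT; apply/eqP => ec.
  by apply: (hlast g dg); rewrite -ec.
- by exists d, ((x, e') :: s); split=> //; split=> //; exists e.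
Qed.

(** Beyond the end of the run the last point is repeated. *)
Fixpoint run_point a s (i : nat) : K :=
  if i is i.+1 then if s is (_, b) :: s then run_point b s i else a else a.

Lemma run_step a s i : run a s -> i <= size s ->
  if onth (unzip1 s) i is Some x then
    TVar x \in letters cl /\
    exists2 b, @rel_of _ _ K (TVar x) (run_point a s i) b &
               agree cl b (run_point a s i.+1)
  else forall b, ~ step (run_point a s i) b.
Proof.
elim: s a i => [|[x b] s IH] a i /=; first by case: i.
move=> [xL hb hs]; case: i => [|i] /= hi; last exact: IH.
by split=> //; case: s {IH hs hi}.
Qed.

End Run.

(** * Truth lemma for the string read along a run *)

Section TruthLemma.
Variables (K : kripke (term V P) P) (cl : seq (formula V P)).
Hypothesis theory : forall A, A \in string_theory cl -> forall a : K, sat (oform A) a.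
Variables (a0 : K) (s : seq (V * K)).
Hypothesis a0_run : run cl a0 s.

Let w := unzip1 s.
Let point i := run_point a0 s i.

(** Formula variables keep the values they have along the run. This is allowed because membership in
    [string_class] is tested after clearing them. *)
Definition run_kripke : kripke V P :=
  @Kripke V P 'I_(size w).+1 (inhabits ord0) (@rel_of _ _ (string_kripke P w))
    (fun p i => @val_of _ _ K p (point i)).

Definition run_struct : gstruct V P :=
  @GStruct V P run_kripke (@univ _ _ (string_struct P w))
    (@univ_refl _ _ (string_struct P w)) (@univ_trans _ _ (string_struct P w))
    (@rel_univ _ _ (string_struct P w)).

Lemma run_struct_class : string_class run_struct.
Proof. by exists w, id; split=> //; exists id. Qed.

Lemma run_rel_lt x (i j : run_kripke) :
  rel_of x i j -> (i : 'I_(size w).+1) < (j : 'I_(size w).+1).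
Proof. by case=> ->. Qed.

Lemma sat_run_var x B (i : run_kripke) :
  FBox (TVar x) B \in cl -> B \in cl ->
  sat (oform (FBox (TVar x) B)) (point (i : 'I__)) <->
  forall j : run_kripke, rel_of x i j -> sat (oform B) (point (j : 'I__)).
Proof.
move=> hx hB; have xL := mem_letters hx.
have hi : (i : 'I_(size w).+1) <= size s.
  by rewrite -(size_map fst) -ltnS; apply: ltn_ord.
have hstep := run_step a0_run hi; rewrite -/w in hstep.
split=> [h j [ej ex]|h b ib].
  move: hstep; rewrite ex => -[_ [b ib]] /(_ _ hB); rewrite /point ej => <-.
  exact: h.
move: hstep; case ex: (onth w _) => [y|]; last first.
  by move=> /(_ b) []; apply/stepP; exists x.
move=> [yL [b' ib' hb']].
(* The run reads [y] here while [b] is an x-successor; the label axiom excludes distinct letters. *)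
have [exy|nxy] := EM (y = x); last first.
  have hl : label_axiom (TVar y) (TVar x) \in string_theory cl.
    by rewrite !mem_cat; apply/or3P/Or32; apply: allpairs_f.
  have := theory hl; rewrite /label_axiom; case: eqP => [[]//|_ /= hlab].
  by case: (hlab (point (i : 'I__)) _ b ib) => /(_ b' ib'); apply; apply: id.
(* If [B] failed at [b], determinism would make it fail at [b'], hence at the next point of the run,
   which agrees with [b'] on [cl]. *)
subst y; apply: contrapT => nb.
have hd : det_axiom (FBox (TVar x) B) \in string_theory cl.
  by rewrite !mem_cat (map_f det_axiom).
have hdet := theory hd.
have : sat (oform (FNeg B)) b'.
  by apply: (hdet (point (i : 'I__)) _ b' ib') => /(_ b ib); apply.
apply; apply/(hb' _ hB).
have lti : (i : 'I_(size w).+1).+1 < (size w).+1.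
  by rewrite ltnS -onthTE ex.
exact: (h (Ordinal lti)).
Qed.

(** The term half evaluates [B] in [K] on both sides. It can thus be applied to boxes of the
    closure, which handles composition and iteration before truth in the string is considered. *)
Lemma truth :
  (forall A, normal A -> {subset closure A <= cl} -> forall i : run_kripke,
     sat A i <-> sat (oform A) (point (i : 'I__))) /\
  (forall t, term_normal t -> forall B, B \in cl -> {subset term_closure t B <= cl} ->
     forall i : run_kripke,
     sat (oform (FBox t B)) (point (i : 'I__)) <->
     forall j : run_kripke, trel t i j -> sat (oform B) (point (j : 'I__))).
Proof.
have sub_cons (T : eqType) (x : T) (s1 l : seq T) : {subset x :: s1 <= l} ->
    x \in l /\ {subset s1 <= l}.
  by move=> h; split=> [|y ys]; apply: h; rewrite in_cons ?eqxx ?ys ?orbT.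
have sub_cat (T : eqType) (s1 s2 l : seq T) : {subset s1 ++ s2 <= l} ->
    {subset s1 <= l} /\ {subset s2 <= l}.
  by move=> h; split=> y ys; apply: h; rewrite mem_cat ?ys ?orbT.
have cl_box t B : {subset term_closure t B <= cl} -> FBox t B \in cl.
  by move=> h; apply: h; case: t => *; rewrite mem_head.
have cl_head A : {subset closure A <= cl} -> A \in cl.
  by move=> h; apply: h; case: A => *; rewrite mem_head.
apply: formula_term_ind => //=.
- move=> A hA B hB /andP[nA nB] /sub_cons[_ /sub_cat[sA sB]] i.
  by rewrite hA // hB.
- move=> t ht A hA /andP[nt nA] /sub_cons[_ /sub_cat[st sA]] i.
  rewrite (ht nt A (cl_head _ sA) st); split=> h j tij; apply/hA => //; exact: h.
- by move=> x _ B hB /sub_cons[hx _] i; apply: sat_run_var.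
- move=> t ht u hu /andP[nt nu] B hB /sub_cons[_ /sub_cat[st su]] i.
  have hseq := @sat_box_seq _ _ K (oterm t) (oterm u) (oform B) (point (i : 'I__)).
  split=> [/hseq/(ht nt _ (cl_box _ _ su) st) h j [k tik ukj]|h].
    exact: ((hu nu B hB su k).1 (h k tik) j ukj).
  apply/hseq/(ht nt _ (cl_box _ _ su) st) => j tij; apply/(hu nu B hB su) => k ujk.
  by apply: h; exists j.
- move=> t ht u hu /andP[nt nu] B hB /sub_cons[_ /sub_cat[st su]] i.
  have halt := @sat_box_alt _ _ K (oterm t) (oterm u) (oform B) (point (i : 'I__)).
  split=> [/halt[/(ht nt B hB st) h1 /(hu nu B hB su) h2] j [/h1|/h2]//|h].
  apply/halt; split; first by apply/(ht nt B hB st) => j tij; apply: h; left.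
  by apply/(hu nu B hB su) => j tij; apply: h; right.
- move=> t ht /andP[strt nt] B hB /sub_cons[hp /sub_cat[st sp]] i.
  have hB' j := ht nt B hB st j; have hP j := ht nt _ hp sp j.
  have hplus j := @sat_box_plus _ _ K (oterm t) (oform B) (point j).
  split=> [h j tij|].
    elim: (clos_trans_t1n _ _ _ _ tij) h => [k l tkl|k l m tkl _ IH] /hplus h.
      by apply: ((hB' k).1 _ l tkl) => b /h[].
    by apply: IH; apply: ((hP k).1 _ l tkl) => b /h[].
  (* Induction on a bound for the number of positions after [i]; a strict term moves forward, so
     none of its steps leaves the last position. *)
  move: {2}(size w - i) (leqnn (size w - (i : 'I__))) => n.
  elim: n i => [|n IH] i hn h; apply/hplus => b tib; split;
    try by apply: ((hB' i).2 _ b tib) => j tij; apply: h; apply: t_step.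
    apply: ((hP i).2 _ b tib) => j tij; have := trel_lt run_rel_lt strt tij.
    have := ltn_ord (j : 'I__); rewrite ltnS => hj hij.
    have := leq_trans hij hj; rewrite ltnNge => /negP[].
    by rewrite -subn_eq0 -leqn0.
  apply: ((hP i).2 _ b tib) => j tij; have hij := trel_lt run_rel_lt strt tij.
  apply: IH => [|k tjk]; last by apply: h; apply: t_trans tjk; apply: t_step.
  rewrite -ltnS; apply: leq_trans hn; apply: ltn_sub2l => //.
  by apply: leq_trans hij _; rewrite -ltnS; apply: ltn_ord.
- move=> A hA nA B hB /sub_cons[_ sA] i.
  have htest := @sat_box_test _ _ K (oform A) (oform B) (point (i : 'I__)).
  split=> [/htest h j [<- /(hA nA sA)]//|h].
  by apply/htest => /(hA nA sA) hAi; apply: h.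
Qed.

End TruthLemma.

(** * Completeness, first for normal formulas *)

Lemma normal_completeness A :
  normal A -> valid_on (@string_class V P) A -> string_derivable A.
Proof.
move=> nA hA; apply: (@consequence _ _ (string_theory (closure A))).
  exact: string_theory_derivable.
move=> K theory a; have [b [s [ab bs]]] := run_exists theory a.
have Acl : A \in closure A by case: (A) => *; rewrite mem_head.
apply/(ab _ Acl); have := hA _ (run_struct_class b s) (ord0 : 'I_(size (unzip1 s)).+1).
by move/((truth theory bs).1 A nA (fun _ h => h)); case: (s).
Qed.

End FischerLadner.

Theorem theorem4 (V P : Type) (A : formula V P) :
  valid_on (@string_class V P) A <-> string_derivable A.
Proof.
split=> [hA|]; last exact: soundness.
have hnf := (nf_correct V P).1 A.
apply: (eqv_derivable hnf); apply: normal_completeness; first exact: (nf_normal V P).1.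
(* Soundness of the provable equivalence carries validity over to the normal form. *)
by move=> S hS a; have /sat_iff h := soundness hnf hS a; apply/h/hA.
Qed.
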